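(* Let $1\le i\le k$ be given integers, and set $\delta=\gcd(i,k)$. Then there exist $\rho\in\mathbb{Z}$ and a sign $\varepsilon\in\{1,-1\}$ such that for any odd prime $p$ we have $$\gcd(p^{i}+1,\,2p^{k-i}+1)=\gcd\left(p^{\delta}+\varepsilon 2^{\rho},\; 2^{i/\delta}-(-1)^{k/\delta}\right).$$
   Context: Since $\rho$ may be negative, the greatest common divisors are computed in the ring $\mathbb{Z}[2^{-1}]$, where they are defined up to units $\pm 2^{m}$ ($m\in\mathbb{Z}$); each is normalized to be a positive odd integer. (The left-hand side is the usual gcd in $\mathbb{Z}$, which is odd because $2p^{k-i}+1$ is odd.) *)

(* Defs.v *)
From HB Require Import structures.
From mathcomp Require Import all_boot all_order all_algebra.

Set Implicit Arguments.
Unset Strict Implicit.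
Unset Printing Implicit Defensive.

Import Order.TTheory GRing.Theory Num.Theory.

Local Open Scope ring_scope.

(* The ring Z[1/2], as a subset of the rationals. *)
Definition Zhalf (x : rat) : Prop :=
  exists (a : int) (m : nat), x = a%:~R / 2%:R ^+ m.

(* Divisibility in Z[1/2]; the quotient is dyadic, so d and x are meant to lie
   in Zhalf (and x does as soon as d does). *)
Definition Zhalf_dvd (d x : rat) : Prop := exists2 c : rat, Zhalf c & x = c * d.

Definition Zhalf_is_gcd (d x y : rat) : Prop :=
  [/\ Zhalf d, Zhalf_dvd d x, Zhalf_dvd d y &
      forall e : rat, Zhalf e -> Zhalf_dvd e x -> Zhalf_dvd e y ->
        Zhalf_dvd e d].

(* [Zhalf_gcd_eq g x y] reads "gcd(x, y) = g" in Z[1/2], where among the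
   associates +-2^m * g the positive odd integer is chosen (odd naturals are
   positive).  By [Zhalf_gcd_eq_uniq] below at most one g qualifies. *)
Definition Zhalf_gcd_eq (g : nat) (x y : rat) : Prop :=
  odd g /\ Zhalf_is_gcd g%:R x y.

Lemma Zhalf_dvd_odd (g h : nat) :
  odd g -> Zhalf_dvd g%:R h%:R -> (g %| h)%N.
Proof.
move=> og [c [a [m ->]]] e.
have n0 : (2%:R ^+ m : rat) != 0 by rewrite expf_neq0.
have /eqP : (h * 2 ^ m)%N%:R = (a * g%:Z)%:~R :> rat.
  by rewrite natrM natrX e rmorphM /= mulrAC divfK.
rewrite -[X in X == _]/((Posz (h * 2 ^ m))%:~R) eqr_int => /eqP E.
have : (g %| h * 2 ^ m)%N.
  by apply/dvdnP; exists `|a|%N; rewrite -[LHS]/`|Posz (h * 2 ^ m)|%N E abszM.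
by rewrite Gauss_dvdl // coprimeXr // coprimen2.
Qed.

Lemma Zhalf_gcd_eq_uniq (g h : nat) (x y : rat) :
  Zhalf_gcd_eq g x y -> Zhalf_gcd_eq h x y -> g = h.
Proof.
move=> [og [Zg gx gy gmax]] [oh [Zh hx hy hmax]].
by apply/eqP; rewrite eqn_dvd !Zhalf_dvd_odd //; [apply: gmax|apply: hmax].
Qed.

(* Main.v *)
Require Import Defs.
From HB Require Import structures.
From mathcomp Require Import all_boot all_order all_algebra.
From mathcomp Require Import ring.

Set Implicit Arguments.
Unset Strict Implicit.
Unset Printing Implicit Defensive.

Import Order.TTheory GRing.Theory Num.Theory.

Local Open Scope ring_scope.

(** Write [i = delta * i'], [k = delta * k'] and [q = p ^ delta].  A modulus
    divides both arguments of the left-hand gcd exactly when [q ^ i' = -1] and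
    [2 * q ^ (k' - i') = -1] modulo it; multiplying the two relations, the
    second one becomes [q ^ k' = 1 / 2].  As [i'] and [k'] are coprime, there
    are naturals with [u * i' = v * k' + 1], so that the two known powers of [q]
    determine [q] itself: [q = q ^ (u * i') / q ^ (v * k') = (-1) ^ u * 2 ^ v].
    Comparing the two ways of computing [q ^ (i' * k')] gives
    [2 ^ i' = (-1) ^ k'].  Conversely these two equations return the original
    ones ([power_system_equiv]).  Hence [rho = v] and [eps = - (-1) ^ u] work.

    With this choice of Bezout coefficients [rho] is nonnegative, so both gcds
    are already gcds of integers having the same divisors
    ([gcd_power_system]), and an odd gcd of integers remains a gcd in
    Z[1/2] by Bezout's identity ([Zhalf_gcd_eq_int]). *)

(** Solving for [q] never divides by 2: one multiplies by a suitable power of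
    [2 * q ^ k = 1] instead.  This is why the equivalence holds in every
    commutative ring, in particular modulo any integer. *)
Lemma power_system_equiv (R : comPzRingType) (q : R) (i k u v : nat) :
    (i <= k)%N -> (u * i = (v * k).+1)%N ->
  (q ^+ i = -1 /\ 2 * q ^+ (k - i) = -1) <->
  (q = (-1) ^+ u * 2 ^+ v /\ 2 ^+ i = (-1) ^+ k :> R).
Proof.
move=> le_ik bez.
have signK n : (-1) ^+ n * (-1) ^+ n = 1 :> R by rewrite -expr2 sqrr_sign.
have qk : q ^+ k = q ^+ (k - i) * q ^+ i by rewrite -exprD subnK.
split=> [[qi qki] | [qE two_i]].
  have two_qk : 2 * q ^+ k = 1 by rewrite qk mulrA qki qi mulrNN mulr1.
  split.
    have qE : q = 2 ^+ v * q ^+ (v * k).+1.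
      by rewrite exprS mulrCA mulnC exprM -exprMn two_qk expr1n mulr1.
    by rewrite [LHS]qE -bez mulnC exprM qi mulrC.
  have inv_two_i : 2 ^+ i * (-1) ^+ k = 1 :> R.
    by rewrite -qi -exprM mulnC exprM -exprMn two_qk expr1n.
  by rewrite -[LHS]mulr1 -[X in _ * X = _](signK k) mulrA inv_two_i mul1r.
have two_ik : 2 ^+ (v * i) = (-1) ^+ (v * k) :> R.
  by rewrite mulnC exprM two_i -exprM mulnC.
have qi : q ^+ i = -1.
  rewrite qE exprMn -!exprM two_ik bez exprS mulN1r mulNr.
  by rewrite signK.
have two_qk : 2 * q ^+ k = 1.
  rewrite qE exprMn -!exprM mulrCA -exprS -bez.
  rewrite [(u * i)%N]mulnC [X in _ * X]exprM two_i -exprM.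
  by rewrite [(k * u)%N]mulnC signK.
split=> //; apply: oppr_inj; rewrite opprK.
by rewrite -[RHS]two_qk qk qi mulrN1 mulrN.
Qed.

Lemma dvdz_intr_Zp (d : nat) (a : int) :
  (1 < d)%N -> (d %| a)%Z <-> a%:~R = 0 :> 'Z_d.
Proof.
move=> d_gt1; rewrite dvdzE /=.
have -> : a%:~R = (-1) ^+ (a < 0)%R * `|a|%N%:R :> 'Z_d.
  by rewrite [a in LHS]intEsign rmorphM rmorph_sign.
have natE : (`|a|%N%:R == 0 :> 'Z_d) = (d %| `|a|)%N.
  by rewrite -val_eqE /= val_Zp_nat.
rewrite -natE mulr_sign; case: ifP => _; last by split=> /eqP.
by rewrite -oppr_eq0; split=> /eqP.
Qed.

(** The coprime case of the theorem, as an identity between gcds of integers.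
    By [power_system_equiv] in the ring of integers modulo [d], the two sides
    are divisible by the same positive [d], and each side is itself such a [d]:
    the left one because [q ^ i + 1] is positive, the right one because
    [2 ^ i] is not [1] or [-1]. *)
Lemma gcd_power_system (q i k u v : nat) :
    (i <= k)%N -> (u * i = (v * k).+1)%N ->
  gcdn (q ^ i + 1) (2 * q ^ (k - i) + 1) =
  gcdn `|(q%:Z + - (-1) ^+ u * 2 ^+ v)%R| `|(2 ^+ i - (-1) ^+ k : int)%R|.
Proof.
move=> le_ik bez; set x := (X in gcdn `|X| _); set y := (X in gcdn _ `|X|).
have same_dvd d : (0 < d)%N ->
    (d %| gcdn (q ^ i + 1) (2 * q ^ (k - i) + 1))%N = (d %| gcdn `|x| `|y|)%N.
  (* The modulus 1 is apart because ['Z_1] denotes the integers modulo 2. *)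
  rewrite leq_eqVlt => /orP[/eqP <- | d_gt1]; first by rewrite !dvd1n.
  rewrite !dvdn_gcd.
  have [sys1 sys2] := power_system_equiv (q%:R : 'Z_d) le_ik bez.
  have AE : ((q ^ i + 1)%N%:Z)%:~R = q%:R ^+ i + 1 :> 'Z_d.
    by rewrite -[LHS]/((q ^ i + 1)%N%:R) natrD natrX.
  have BE : ((2 * q ^ (k - i) + 1)%N%:Z)%:~R = 2 * q%:R ^+ (k - i) + 1 :> 'Z_d.
    by rewrite -[LHS]/((2 * q ^ (k - i) + 1)%N%:R) natrD natrM natrX.
  have xE : x%:~R = q%:R - (-1) ^+ u * 2 ^+ v :> 'Z_d.
    by rewrite /x rmorphD /= mulNr rmorphN rmorphM rmorph_sign rmorphXn.
  have yE : y%:~R = 2 ^+ i - (-1) ^+ k :> 'Z_d.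
    by rewrite /y rmorphB /= rmorph_sign rmorphXn.
  have dvdE (a : int) : (d %| `|a|)%N <-> a%:~R = 0 :> 'Z_d.
    exact: dvdz_intr_Zp.
  apply/andP/andP=> -[].
    move=> /(dvdE (Posz _)); rewrite AE => /eqP; rewrite addr_eq0 => /eqP qi.
    move=> /(dvdE (Posz _)); rewrite BE => /eqP; rewrite addr_eq0 => /eqP qki.
    have [qE twoE] := sys1 (conj qi qki).
    by split; apply/dvdE; rewrite ?xE ?yE; apply/eqP; rewrite subr_eq0;
      apply/eqP.
  move=> /dvdE; rewrite xE => /eqP; rewrite subr_eq0 => /eqP qE.
  move=> /dvdE; rewrite yE => /eqP; rewrite subr_eq0 => /eqP twoE.
  have [qi qki] := sys2 (conj qE twoE).
  by split; apply/(dvdE (Posz _)); rewrite ?AE ?BE ?qi ?qki addNr.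
have i_gt0 : (0 < i)%N by case: i bez {le_ik x y same_dvd} => //; rewrite muln0.
have y_neq0 : y != 0.
  rewrite subr_eq0; apply/eqP=> /(congr1 (fun z : int => `|z|%N)).
  rewrite abszX abszX /= exp1n => /eqP.
  by rewrite -(expn0 2) eqn_exp2l // (gtn_eqF i_gt0).
set g := gcdn (q ^ i + 1) _ in same_dvd *; set h := gcdn `|x| _ in same_dvd *.
have g_gt0 : (0 < g)%N by rewrite gcdn_gt0 addn1.
have h_gt0 : (0 < h)%N by rewrite gcdn_gt0 [X in _ || X]absz_gt0 y_neq0 orbT.
by apply/eqP; rewrite eqn_dvd -(same_dvd g g_gt0) (same_dvd h h_gt0) !dvdnn.
Qed.

Lemma Zhalf_int (a : int) : Zhalf a%:~R.
Proof. by exists a, 0%N; rewrite expr0 divr1. Qed.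

Lemma Zhalf_lin (a b : int) (x y : rat) :
  Zhalf x -> Zhalf y -> Zhalf (a%:~R * x + b%:~R * y).
Proof.
move=> [c [m ->]] [d [n ->]].
exists (a * c * 2 ^+ n + b * d * 2 ^+ m), (m + n)%N.
have pow_neq0 l : (2 : rat) ^+ l != 0 by rewrite expf_neq0.
rewrite rmorphD !rmorphM /= !rmorphXn /= exprD.
by field; rewrite !pow_neq0.
Qed.

Lemma Zhalf_dvd_int (d a : int) : (d %| a)%Z -> Zhalf_dvd d%:~R a%:~R.
Proof.
move=> /dvdzP[c ->]; exists c%:~R; first exact: Zhalf_int.
by rewrite rmorphM.
Qed.

(** Passing to Z[1/2] only forgets powers of 2 in a gcd of integers, and an odd
    gcd has none to lose; maximality among dyadic common divisors is Bezout's
    identity over the integers. *)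
Lemma Zhalf_gcd_eq_int (a b : int) :
  odd (gcdn `|a| `|b|) -> Zhalf_gcd_eq (gcdn `|a| `|b|) a%:~R b%:~R.
Proof.
move=> odd_g; split=> //; rewrite -[_%:R]/((gcdz a b)%:~R).
split; first exact: Zhalf_int.
- exact/Zhalf_dvd_int/dvdz_gcdl.
- exact/Zhalf_dvd_int/dvdz_gcdr.
move=> e _ [c Zc aE] [d Zd bE]; have [u [v <-]] := Bezoutz a b.
exists (u%:~R * c + v%:~R * d); first exact: Zhalf_lin.
by rewrite rmorphD !rmorphM /= aE bE mulrDl !mulrA.
Qed.

Theorem corollary3p2 (i k : nat) (hi : (1 <= i)%N) (hik : (i <= k)%N) :
  let delta := gcdn i k in
  exists (rho : int) (eps : int), (eps = 1 \/ eps = -1) /\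
    forall p : nat, prime p -> odd p ->
      Zhalf_gcd_eq (gcdn (p ^ i + 1) (2 * p ^ (k - i) + 1))
        (p%:R ^+ delta + eps%:~R * 2%:R ^ rho)
        (2%:R ^+ (i %/ delta)%N - (-1) ^+ (k %/ delta)%N).
Proof.
move=> delta; have delta_gt0 : (0 < delta)%N by rewrite gcdn_gt0 hi.
have [u v bez _] := egcdnP k hi; rewrite -/delta in bez.
have iE : (i = delta * (i %/ delta))%N by rewrite mulnC divnK ?dvdn_gcdl.
have kE : (k = delta * (k %/ delta))%N by rewrite mulnC divnK ?dvdn_gcdr.
set i' := (i %/ delta)%N in iE *; set k' := (k %/ delta)%N in kE *.
have bez' : (u * i' = (v * k').+1)%N.
  apply/eqP; rewrite -(eqn_pmul2l delta_gt0) mulnCA -iE bez mulnS mulnCA -kE.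
  by rewrite addnC.
have le_ik' : (i' <= k')%N by rewrite leq_div2r.
exists v%:Z, (- (-1) ^+ u); split.
  by rewrite -signr_odd; case: (odd u); [left | right].
move=> p _ _.
have -> : (gcdn (p ^ i + 1) (2 * p ^ (k - i) + 1) =
           gcdn ((p ^ delta) ^ i' + 1) (2 * (p ^ delta) ^ (k' - i') + 1))%N.
  by rewrite -!expnM mulnBr -iE -kE.
have gcdE := gcd_power_system (p ^ delta) le_ik' bez'.
rewrite gcdE; set x := (X in gcdn `|X| _); set y := (X in gcdn _ `|X|).
have -> : p%:R ^+ delta + (- (-1) ^+ u)%:~R * 2%:R ^ v%:Z = x%:~R :> rat.
  rewrite /x rmorphD rmorphM /= [(2 ^+ v)%:~R]rmorphXn.
  by rewrite -[(p ^ delta)%N%:~R]/((p ^ delta)%N%:R) natrX.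
have -> : 2%:R ^+ i' - (-1) ^+ k' = y%:~R :> rat.
  by rewrite /y rmorphB /= rmorph_sign rmorphXn.
apply: Zhalf_gcd_eq_int; rewrite -gcdE.
apply: (@dvdn_odd _ (2 * (p ^ delta) ^ (k' - i') + 1)%N).
  exact: dvdn_gcdr.
by rewrite oddD oddM.
Qed.
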